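(* Let $\varphi=\frac{1+\sqrt5}{2}$. The radius of convergence of the power series $[\varphi]_q$ (the $q$-deformation of $\varphi$, with $q$ a complex variable) is equal to $R_\star=\frac{3-\sqrt5}{2}$.
   Context: For an integer $c\ge 1$ let $[c]_q = 1+q+\cdots+q^{c-1}$. Every rational $x>0$ has a unique finite Hirzebruch-Jung continued fraction expansion $$x=\llbracket c_1,\ldots,c_N\rrbracket := c_1-\cfrac{1}{c_2-\cfrac{1}{\ddots-\cfrac{1}{c_N}}},$$ with integers $c_1\ge 1$ and $c_j\ge 2$ for $j\ge 2$. The $q$-deformation of a rational $x>0$ is the rational function $$[x]_q := [c_1]_q-\cfrac{q^{c_1-1}}{[c_2]_q-\cfrac{q^{c_2-1}}{\ddots-\cfrac{q^{c_{N-1}-1}}{[c_N]_q}}},$$ which is regular at $q=0$. For an irrational $x\ge 1$, let $(x_n)_{n\ge1}$ be any sequence of rationals converging to $x$, and let $[x_n]_q=\sum_{k\ge0}\varkappa_{n,k}q^k$ be the Taylor expansions at $q=0$. It is known (Morier-Genoud and Ovsienko) that for each $k$ the coefficients $\varkappa_{n,k}$ are eventually constant in $n$, and that the limit $\varkappa_k=\lim_{n\to\infty}\varkappa_{n,k}$ depends only on $x$. The $q$-deformation of $x$ is the power series $[x]_q:=\sum_{k\ge 0}\varkappa_k q^k$. *)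

(* Defs.v *)
From Stdlib Require Import Reals QArith_base Qreals List ClassicalEpsilon.
From Coquelicot Require Import Coquelicot.
Open Scope R_scope.

Fixpoint q_int (c : nat) (q : C) : C :=
  match c with
  | O => 0%C
  | S c' => (q_int c' q + q ^ c')%C
  end.

(* The nonempty list [c_1, ..., c_N] is passed as its head and its tail. *)
Definition hj_valid (c : nat) (l : list nat) : Prop :=
  (1 <= c)%nat /\ List.Forall (fun d => (2 <= d)%nat) l.

Fixpoint hj (c : nat) (l : list nat) : R :=
  match l with
  | nil => INR c
  | d :: l' => INR c - / hj d l'
  end.

(* The rational function of the variable q attached to [c_1, ..., c_N].  It is
   only used near q = 0, where every denominator is nonzero: for a valid list,
   the continued fraction starting at c_j, j >= 2, has value 1 at q = 0. *)
Fixpoint hj_q (c : nat) (l : list nat) (q : C) : C :=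
  match l with
  | nil => q_int c q
  | d :: l' => (q_int c q - q ^ (c - 1) / hj_q d l' q)%C
  end.

Definition taylor_at_0 (f : C -> C) (a : nat -> C) : Prop :=
  exists r : R, 0 < r /\ forall q : C, Cmod q < r ->
    is_pseries (K := C_AbsRing) (V := C_NormedModule) a q (f q).

(* [a] is the sequence of Taylor coefficients at q = 0 of [x]_q, x rational;
   this forces x > 0, since the value of a valid expansion is positive. *)
Definition q_rational_taylor (x : Q) (a : nat -> C) : Prop :=
  exists (c : nat) (l : list nat),
    hj_valid c l /\ Q2R x = hj c l /\ taylor_at_0 (hj_q c l) a.

(* Meant for irrational x >= 1 (at a rational x the coefficients need not
   stabilize).  The sequence xs is only eventually positive, so [xs n]_q is
   required to exist for large n only. *)
Definition is_q_real (x : R) (kappa : nat -> C) : Prop :=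
  forall xs : nat -> Q, is_lim_seq (fun n => Q2R (xs n)) x ->
  forall k : nat, eventually (fun n =>
    exists a : nat -> C, q_rational_taylor (xs n) a /\ a k = kappa k).

(* The coefficients of [x]_q; arbitrary if no sequence satisfies [is_q_real]. *)
Definition q_real (x : R) : nat -> C :=
  epsilon (inhabits (fun _ : nat => 0%C)) (is_q_real x).

(* The supremum of |q| over the complex q at which the series converges;
   Coquelicot's [CV_radius] is restricted to real power series. *)
Definition C_CV_radius (a : nat -> C) : Rbar :=
  Lub_Rbar (fun r : R => exists q : C, Cmod q = r /\
    ex_pseries (K := C_AbsRing) (V := C_NormedModule) a q).

Definition golden_ratio : R := (1 + sqrt 5) / 2.

(* Main.v *)
(* Since phi = [[2, 3, 3, 3, ...]], a rational close to phi has an expansion that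
   starts with 2, 3, ..., 3, and each further digit 3 fixes more Taylor coefficients
   at q = 0.  In the limit [phi]_q = [2]_q - q W with W = 1 / [phi^2]_q and
   [phi^2]_q = [3]_q - q^2 W.  Putting W(q) = S(-q), this becomes
   S = 1 + x S + x^2 (S^2 - S), whose solution has nonnegative coefficients, so that
   everything reduces to S at positive x.  Let R = (3 - sqrt 5) / 2.  At x = R the
   right-hand side, as a function of S, has the fixed point 1 / R, which bounds all
   partial sums, so [phi]_q converges on the closed disc of radius R.  For
   R < x < 1 the quadratic equation has discriminant
   (1 - 3 x + x^2) (1 + x + x^2) < 0, so S diverges there. *)

Require Import Defs.
From Stdlib Require Import Reals Lra Lia List ZArith QArith_base ClassicalEpsilon.
From Coquelicot Require Import Coquelicot.
Open Scope R_scope.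

(** * Complex series and their Cauchy products *)

Lemma sum_n_C (a : nat -> C) (n : nat) :
  sum_n (G := C_AbelianMonoid) a n =
  (sum_n (fun k => Re (a k)) n, sum_n (fun k => Im (a k)) n).
Proof.
  induction n as [|n IH].
  - rewrite !sum_O. now destruct (a 0%nat).
  - rewrite !sum_Sn, IH. reflexivity.
Qed.

Lemma is_series_C (a : nat -> C) (l : C) :
  is_series (K := C_AbsRing) (V := C_NormedModule) a l <->
  is_series (fun n => Re (a n)) (Re l) /\ is_series (fun n => Im (a n)) (Im l).
Proof.
  unfold is_series; split.
  - intros H. split.
    + apply filterlim_ext with (fun n => Re (sum_n (G := C_AbelianMonoid) a n)).
      { intros n; now rewrite sum_n_C. }
      refine (filterlim_comp _ _ _ _ _ _ _ _ H _).
      intros P [e He]; exists e; intros y Hy; apply He; apply Hy.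
    + apply filterlim_ext with (fun n => Im (sum_n (G := C_AbelianMonoid) a n)).
      { intros n; now rewrite sum_n_C. }
      refine (filterlim_comp _ _ _ _ _ _ _ _ H _).
      intros P [e He]; exists e; intros y Hy; apply He; apply Hy.
  - intros [H1 H2]. intros P [e He].
    assert (A : eventually (fun n => ball (Re l) e (sum_n (fun k => Re (a k)) n)))
      by (apply H1, locally_ball).
    assert (B : eventually (fun n => ball (Im l) e (sum_n (fun k => Im (a k)) n)))
      by (apply H2, locally_ball).
    generalize (filter_and _ _ A B). unfold filtermap.
    apply filter_imp. intros n [A' B']. apply He. rewrite sum_n_C.
    split; assumption.
Qed.

Lemma pow_n_C (q : C) (n : nat) : pow_n (K := C_Ring) q n = (q ^ n)%C.
Proof. induction n as [|n IH]; simpl; [|rewrite IH]; reflexivity. Qed.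

Lemma is_pseries_C (a : nat -> C) (q l : C) :
  is_pseries (K := C_AbsRing) (V := C_NormedModule) a q l <->
  is_series (K := C_AbsRing) (V := C_NormedModule) (fun n => (a n * q ^ n)%C) l.
Proof.
  unfold is_pseries.
  assert (E : forall n, scal (V := C_NormedModule) (pow_n (K := C_AbsRing) q n) (a n)
              = (a n * q ^ n)%C).
  { intros n. change ((pow_n (K := C_Ring) q n * a n)%C = (a n * q ^ n)%C).
    rewrite pow_n_C. apply Cmult_comm. }
  split; apply is_series_ext; intros n; rewrite E; reflexivity.
Qed.

Lemma C_ex_series_lim_0 (a : nat -> C) :
  ex_series (K := C_AbsRing) (V := C_NormedModule) a ->
  is_lim_seq (fun n => Cmod (a n)) 0.
Proof.
  intros [l H]. apply is_series_C in H. destruct H as [H1 H2].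
  assert (L1 := ex_series_lim_0 _ (ex_intro _ _ H1)).
  assert (L2 := ex_series_lim_0 _ (ex_intro _ _ H2)).
  apply is_lim_seq_abs in L1. apply is_lim_seq_abs in L2.
  simpl in L1, L2. rewrite Rabs_R0 in L1, L2.
  apply is_lim_seq_le_le with (u := fun _ => 0)
    (w := fun n => Rabs (Re (a n)) + Rabs (Im (a n))).
  - intros n. split; [apply Cmod_ge_0|].
    assert (E : a n = (RtoC (Re (a n)) + Ci * RtoC (Im (a n)))%C)
      by (destruct (a n); apply injective_projections; simpl; ring).
    rewrite E at 1. eapply Rle_trans; [apply Cmod_triangle|].
    rewrite Cmod_mult, Cmod_Ci, !Cmod_R. lra.
  - apply is_lim_seq_const.
  - replace (Finite 0) with (Finite (0 + 0)) by (f_equal; ring).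
    now apply is_lim_seq_plus'.
Qed.

(** The real and imaginary parts of the product are combinations of four real Cauchy products. The
    real theorem applies to each, since the parts of an absolutely convergent complex series
    converge absolutely. *)
Lemma is_series_mult_C (a b : nat -> C) (la lb : C) :
  is_series (K := C_AbsRing) (V := C_NormedModule) a la ->
  is_series (K := C_AbsRing) (V := C_NormedModule) b lb ->
  ex_series (fun n => Cmod (a n)) -> ex_series (fun n => Cmod (b n)) ->
  is_series (K := C_AbsRing) (V := C_NormedModule)
    (fun n => sum_n (G := C_AbelianMonoid) (fun k => (a k * b (n - k)%nat)%C) n)
    (la * lb)%C.
Proof.
  intros Ha Hb Sa Sb.
  apply is_series_C in Ha; apply is_series_C in Hb.
  destruct Ha as [Ha1 Ha2], Hb as [Hb1 Hb2].
  assert (im_le : forall c : C, Rabs (Im c) <= Cmod c).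
  { intros c. eapply Rle_trans; [apply Rmax_r | apply Rmax_Cmod]. }
  assert (A1 : forall c, ex_series (fun n => Cmod (c n)) ->
            ex_series (fun n => Rabs (Re (c n)))).
  { intros c H.
    apply (ex_series_le (K := R_AbsRing) (V := R_CompleteNormedModule) _ _)
      with (2 := H). intros n.
    change (Rabs (Rabs (Re (c n))) <= Cmod (c n)). rewrite Rabs_Rabsolu.
    apply re_le_Cmod. }
  assert (A2 : forall c, ex_series (fun n => Cmod (c n)) ->
            ex_series (fun n => Rabs (Im (c n)))).
  { intros c H.
    apply (ex_series_le (K := R_AbsRing) (V := R_CompleteNormedModule) _ _)
      with (2 := H). intros n.
    change (Rabs (Rabs (Im (c n))) <= Cmod (c n)). rewrite Rabs_Rabsolu.
    apply im_le. }
  apply is_series_C; split.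
  - apply is_series_ext with (fun n => minus
      (sum_f_R0 (fun k => Re (a k) * Re (b (n - k)%nat)) n)
      (sum_f_R0 (fun k => Im (a k) * Im (b (n - k)%nat)) n)).
    { intros n. rewrite sum_n_C. cbn [Re fst].
      rewrite sum_n_Reals. symmetry. apply minus_sum. }
    rewrite re_mult.
    apply (is_series_minus (K := R_AbsRing) (V := R_NormedModule)).
    + apply (is_series_mult (fun k => Re (a k)) (fun k => Re (b k))); auto.
    + apply (is_series_mult (fun k => Im (a k)) (fun k => Im (b k))); auto.
  - apply is_series_ext with (fun n => plus
      (sum_f_R0 (fun k => Re (a k) * Im (b (n - k)%nat)) n)
      (sum_f_R0 (fun k => Im (a k) * Re (b (n - k)%nat)) n)).
    { intros n. rewrite sum_n_C. cbn [Im snd].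
      rewrite sum_n_Reals. symmetry. apply plus_sum. }
    rewrite im_mult.
    apply (is_series_plus (K := R_AbsRing) (V := R_NormedModule)).
    + apply (is_series_mult (fun k => Re (a k)) (fun k => Im (b k))); auto.
    + apply (is_series_mult (fun k => Im (a k)) (fun k => Re (b k))); auto.
Qed.

Lemma ex_series_Cmod (a : nat -> C) :
  ex_series (fun n => Cmod (a n)) ->
  ex_series (K := C_AbsRing) (V := C_NormedModule) a.
Proof.
  apply (ex_series_le (K := C_AbsRing) (V := C_CompleteNormedModule)).
  intros n. apply Rle_refl.
Qed.

Lemma ex_series_Cmod_pseries (a : nat -> R) (q : C) :
  Rbar_lt (Cmod q) (CV_radius a) ->
  ex_series (fun n => Cmod (RtoC (a n) * q ^ n)).
Proof.
  intros H.
  apply ex_series_ext with (fun n => Rabs (a n * Cmod q ^ n)).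
  - intros n. rewrite Cmod_mult, Cmod_R, Cmod_pow, Rabs_mult.
    rewrite (Rabs_pos_eq (_ ^ n)); [reflexivity|]. apply pow_le, Cmod_ge_0.
  - apply CV_disk_inside. rewrite Rabs_pos_eq; [assumption | apply Cmod_ge_0].
Qed.

Lemma sum_n_RtoC_mult (u : nat -> R) (z : C) (n : nat) :
  sum_n (G := C_AbelianMonoid) (fun k => (RtoC (u k) * z)%C) n =
  (RtoC (sum_f_R0 u n) * z)%C.
Proof.
  induction n as [|n IH].
  - apply sum_O.
  - rewrite sum_Sn, IH. simpl sum_f_R0. rewrite RtoC_plus.
    match goal with |- plus ?x ?y = ?z => change (Cplus x y = z) end. ring.
Qed.

Lemma is_pseries_mult_C (a b : nat -> R) (q la lb : C) :
  is_pseries (K := C_AbsRing) (V := C_NormedModule) (fun n => RtoC (a n)) q la ->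
  is_pseries (K := C_AbsRing) (V := C_NormedModule) (fun n => RtoC (b n)) q lb ->
  Rbar_lt (Cmod q) (CV_radius a) -> Rbar_lt (Cmod q) (CV_radius b) ->
  is_pseries (K := C_AbsRing) (V := C_NormedModule)
    (fun n => RtoC (PS_mult a b n)) q (la * lb)%C.
Proof.
  intros Ha Hb Ra Rb.
  apply is_pseries_C in Ha; apply is_pseries_C in Hb; apply is_pseries_C.
  generalize (is_series_mult_C _ _ _ _ Ha Hb (ex_series_Cmod_pseries _ _ Ra)
    (ex_series_Cmod_pseries _ _ Rb)).
  apply is_series_ext. intros n. unfold PS_mult.
  rewrite (sum_n_ext_loc _ (fun k => (RtoC (a k * b (n - k)%nat) * q ^ n)%C)).
  - apply (sum_n_RtoC_mult (fun k => a k * b (n - k)%nat)).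
  - intros k Hk.
    assert (E : (q ^ n)%C = (q ^ k * q ^ (n - k))%C)
      by (rewrite <- Cpow_add_r; f_equal; lia).
    rewrite E, RtoC_mult.
    match goal with |- ?x = ?y => change (@eq C x y) end. ring.
Qed.

(** * Uniqueness of Taylor coefficients *)

Lemma CV_radius_pos (a : nat -> R) (r : R) :
  0 < r -> (forall t, Rabs t < r -> ex_pseries a t) -> Rbar_lt 0 (CV_radius a).
Proof.
  intros Hr H.
  assert (E : ex_pseries a (r / 2)) by (apply H; rewrite Rabs_pos_eq; lra).
  destruct (Rbar_lt_le_dec (CV_radius a) (Rabs (r / 2))) as [L|L].
  - exfalso. apply (CV_disk_outside _ _ L).
    apply ex_series_lim_0. destruct E as [l E]. exists l.
    now apply is_pseries_R.
  - apply Rbar_lt_le_trans with (2 := L). simpl. rewrite Rabs_pos_eq; lra.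
Qed.

(** Restricting to real arguments separates the real and imaginary parts of the coefficients, so
    uniqueness follows from the real case. *)
Lemma taylor_at_0_real (f : C -> C) (a : nat -> C) :
  taylor_at_0 f a -> exists r, 0 < r /\ forall t, Rabs t < r ->
    is_pseries (fun n => Re (a n)) t (Re (f t)) /\
    is_pseries (fun n => Im (a n)) t (Im (f t)).
Proof.
  intros [r [Hr H]]. exists r. split; [assumption|]. intros t Ht.
  assert (S : Cmod t < r) by now rewrite Cmod_R.
  apply H, is_pseries_C, is_series_C in S. destruct S as [S1 S2].
  split; apply is_pseries_R.
  - revert S1. apply is_series_ext. intros n.
    rewrite <- RtoC_pow. apply re_scal_r.
  - revert S2. apply is_series_ext. intros n.
    rewrite <- RtoC_pow. apply im_scal_r.
Qed.

Lemma taylor_at_0_CV_radius (f : C -> C) (a : nat -> R) :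
  taylor_at_0 f (fun n => RtoC (a n)) -> Rbar_lt 0 (CV_radius a).
Proof.
  intros H. destruct (taylor_at_0_real _ _ H) as [r [Hr K]].
  apply CV_radius_pos with r; [assumption|].
  intros t Ht. eexists. apply (proj1 (K t Ht)).
Qed.

Lemma pseries_coef_unique (f : R -> R) (a b : nat -> R) (r : R) :
  0 < r -> (forall t, Rabs t < r -> is_pseries a t (f t)) ->
  (forall t, Rabs t < r -> is_pseries b t (f t)) -> forall n, a n = b n.
Proof.
  intros Hr Ha Hb n. apply PSeries_ext_recip.
  - apply CV_radius_pos with r; [assumption|]. intros t Ht. eexists; apply Ha, Ht.
  - apply CV_radius_pos with r; [assumption|]. intros t Ht. eexists; apply Hb, Ht.
  - exists (mkposreal r Hr). intros t Ht.
    assert (T : Rabs t < r).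
    { change (Rabs (t - 0) < r) in Ht. now rewrite Rminus_0_r in Ht. }
    rewrite (is_pseries_unique _ _ _ (Ha t T)).
    now rewrite (is_pseries_unique _ _ _ (Hb t T)).
Qed.

Lemma taylor_at_0_unique (f : C -> C) (a b : nat -> C) :
  taylor_at_0 f a -> taylor_at_0 f b -> forall n, a n = b n.
Proof.
  intros Ha Hb n.
  destruct (taylor_at_0_real _ _ Ha) as [r [Hr A]].
  destruct (taylor_at_0_real _ _ Hb) as [s [Hs B]].
  assert (M : 0 < Rmin r s) by now apply Rmin_glb_lt.
  assert (Ml := Rmin_l r s). assert (Mr := Rmin_r r s).
  apply injective_projections.
  - apply (pseries_coef_unique (fun t => Re (f t)) (fun k => Re (a k))
      (fun k => Re (b k)) (Rmin r s) M); intros t Ht;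
      [apply A | apply B]; lra.
  - apply (pseries_coef_unique (fun t => Im (f t)) (fun k => Im (a k))
      (fun k => Im (b k)) (Rmin r s) M); intros t Ht;
      [apply A | apply B]; lra.
Qed.

(** * Recursively defined sequences and formal inverses *)

(** Course-of-values recursion as a fixed-point problem: for such an [F] the iterates from 0 have a
    stable entry of index n from step n + 1 on, and [fix_seq] reads off that diagonal. *)
Definition causal (F : (nat -> R) -> nat -> R) : Prop :=
  forall f g n, (forall k, (k < n)%nat -> f k = g k) -> F f n = F g n.

Fixpoint fix_iter (F : (nat -> R) -> nat -> R) (m : nat) : nat -> R :=
  match m with
  | O => fun _ => 0
  | S m' => F (fix_iter F m')
  end.

Definition fix_seq (F : (nat -> R) -> nat -> R) (n : nat) : R :=
  fix_iter F (S n) n.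

Lemma fix_iter_stable (F : (nat -> R) -> nat -> R) :
  causal F -> forall m p n, (n < m)%nat -> (n < p)%nat ->
  fix_iter F m n = fix_iter F p n.
Proof.
  intros HF. induction m as [|m IH]; intros p n Hm Hp; [lia|].
  destruct p as [|p]; [lia|]. simpl. apply HF. intros k Hk. apply IH; lia.
Qed.

Lemma fix_seq_eq (F : (nat -> R) -> nat -> R) :
  causal F -> forall n, fix_seq F n = F (fix_seq F) n.
Proof.
  intros HF n. unfold fix_seq at 1. simpl. apply HF.
  intros k Hk. apply fix_iter_stable; auto.
Qed.

(** The convolution identity a * f = 1 with a 0 = 1, solved for the coefficient of f of highest
    index. *)
Definition inv_step (a f : nat -> R) (n : nat) : R :=
  match n with
  | O => 1
  | S m => - sum_f_R0 (fun k => a (S k) * f (m - k)%nat) m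
  end.

(* Only meaningful when [a 0 = 1]: the constant term of [a] is never read. *)
Definition PS_inv (a : nat -> R) : nat -> R := fix_seq (inv_step a).

Lemma inv_step_causal (a : nat -> R) : causal (inv_step a).
Proof.
  intros f g [|n] H; [reflexivity|]. simpl. f_equal.
  apply sum_eq. intros k Hk. rewrite H; [reflexivity | lia].
Qed.

Lemma PS_inv_0 (a : nat -> R) : PS_inv a 0 = 1.
Proof. reflexivity. Qed.

Lemma PS_inv_S (a : nat -> R) (n : nat) :
  PS_inv a (S n) = - sum_f_R0 (fun k => a (S k) * PS_inv a (n - k)%nat) n.
Proof. unfold PS_inv at 1. now rewrite fix_seq_eq by apply inv_step_causal. Qed.

Lemma PS_mult_S (a b : nat -> R) (n : nat) :
  PS_mult a b (S n) =
  a 0%nat * b (S n) + sum_f_R0 (fun k => a (S k) * b (n - k)%nat) n.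
Proof.
  unfold PS_mult. rewrite decomp_sum by lia. reflexivity.
Qed.

Lemma PS_inv_mult (a : nat -> R) :
  a 0%nat = 1 -> forall n, PS_mult a (PS_inv a) n = if n then 1 else 0.
Proof.
  intros H [|n].
  - unfold PS_mult. simpl. rewrite H, PS_inv_0. ring.
  - rewrite PS_mult_S, H, PS_inv_S. ring.
Qed.

(** The coefficient of index k of an inverse depends only on coefficients of index at most k. The
    inverse [w] enters through its recurrence because the intended one, [golden_sq_inv], is built
    from [rna] and not by [PS_inv]. *)
Lemma PS_inv_agree (a w : nat -> R) (m : nat) :
  w 0%nat = 1 ->
  (forall n, w (S n) = - sum_f_R0 (fun k => a (S k) * w (n - k)%nat) n) ->
  forall b, (forall k, (k <= m)%nat -> b k = a k) ->
  forall k, (k <= m)%nat -> PS_inv b k = w k.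
Proof.
  intros H0 HS b Hb k. induction k as [[|k] IH] using lt_wf_ind; intros Hk.
  - now rewrite PS_inv_0.
  - rewrite PS_inv_S, HS. f_equal. apply sum_eq. intros j Hj.
    rewrite Hb, IH by lia. reflexivity.
Qed.

(** * Convergence of the formal inverse near 0 *)

Lemma sum_pow_2 (n : nat) : sum_f_R0 (fun k => 2 ^ (n - k)) n <= 2 ^ S n.
Proof.
  enough (H : sum_f_R0 (fun k => 2 ^ (n - k)) n = 2 ^ S n - 1) by lra.
  induction n as [|n IH]; [simpl; ring|].
  rewrite decomp_sum by lia. simpl pred.
  rewrite (sum_eq _ (fun k => 2 ^ (n - k))) by (intros; reflexivity).
  rewrite IH. simpl. ring.
Qed.

(** By strong induction the terms of the recurrence are at most rho^(n+1) 2^(n-k), and the powers of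
    2 sum to less than 2^(n+1). *)
Lemma PS_inv_bound (a : nat -> R) (rho : R) :
  0 <= rho -> (forall n, Rabs (a (S n)) <= rho ^ S n) ->
  forall n, Rabs (PS_inv a n) <= (2 * rho) ^ n.
Proof.
  intros Hr Ha n. induction n as [[|n] IH] using lt_wf_ind.
  - rewrite PS_inv_0, Rabs_R1. simpl. lra.
  - rewrite PS_inv_S, Rabs_Ropp.
    eapply Rle_trans; [apply Rsum_abs|].
    apply Rle_trans with (sum_f_R0 (fun k => 2 ^ (n - k) * rho ^ S n) n).
    + apply sum_Rle. intros k Hk. rewrite Rabs_mult.
      replace (2 ^ (n - k) * rho ^ S n) with (rho ^ S k * (2 * rho) ^ (n - k)).
      * apply Rmult_le_compat; try apply Rabs_pos; [apply Ha | apply IH; lia].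
      * rewrite Rpow_mult_distr. replace (S n) with (S k + (n - k))%nat by lia.
        rewrite pow_add. replace (S k + (n - k) - S k)%nat with (n - k)%nat by lia.
        ring.
    + rewrite <- scal_sum, Rpow_mult_distr, Rmult_comm.
      apply Rmult_le_compat_r; [now apply pow_le | apply sum_pow_2].
Qed.

Lemma CV_radius_geometric (a : nat -> R) (rho : R) :
  0 < rho -> (forall n, Rabs (a n) <= rho ^ n) -> Rbar_le (/ rho) (CV_radius a).
Proof.
  intros Hr H. apply (proj1 (CV_radius_bounded a)). exists 1. intros n.
  rewrite Rabs_mult, (Rabs_pos_eq (_ ^ n))
    by (apply pow_le; left; now apply Rinv_0_lt_compat).
  rewrite pow_inv. apply Rmult_le_reg_r with (rho ^ n).
  - now apply pow_lt.
  - rewrite Rmult_assoc, Rinv_l, Rmult_1_r, Rmult_1_l; [apply H|].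
    apply Rgt_not_eq, pow_lt, Hr.
Qed.

Lemma CV_radius_geometric_inv (a : nat -> R) :
  Rbar_lt 0 (CV_radius a) ->
  exists rho, 0 < rho /\ forall n, Rabs (a (S n)) <= rho ^ S n.
Proof.
  intros H.
  assert (E : exists r, 0 < r /\ Rbar_lt (Rabs r) (CV_radius a)).
  { destruct (CV_radius a) as [x| |]; simpl in H.
    - exists (x / 2). simpl. rewrite Rabs_pos_eq; lra.
    - exists 1. split; [lra | exact I].
    - contradiction. }
  destruct E as [r [Hr Hc]].
  assert (L := ex_series_lim_0 _ (CV_disk_inside _ _ Hc)).
  destruct (filterlim_bounded (K := R_AbsRing) (V := R_NormedModule)
    (fun n => Rabs (a n * r ^ n))) as [M HM].
  { exists 0. exact L. }
  assert (HM' : forall n, Rabs (a n) * r ^ n <= Rmax 1 M).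
  { intros n. eapply Rle_trans; [|apply Rmax_r]. eapply Rle_trans; [|apply (HM n)].
    change (Rabs (a n) * r ^ n <= Rabs (Rabs (a n * r ^ n))).
    rewrite Rabs_Rabsolu, Rabs_mult, (Rabs_pos_eq (r ^ n)); [lra|].
    apply pow_le; lra. }
  assert (M1 := Rmax_l 1 M). set (B := Rmax 1 M) in *.
  (* Since B >= 1, the constant B is at most B^(n+1) and can be absorbed into the ratio; this is why
     the bound starts at index 1. *)
  exists (B / r). split.
  - apply Rdiv_lt_0_compat; lra.
  - intros n. unfold Rdiv. rewrite Rpow_mult_distr, pow_inv.
    apply Rmult_le_reg_r with (r ^ S n); [apply pow_lt; lra|].
    rewrite Rmult_assoc, Rinv_l, Rmult_1_r
      by (apply Rgt_not_eq, pow_lt; lra).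
    eapply Rle_trans; [apply HM'|].
    rewrite <- (Rmult_1_r B) at 1. simpl pow.
    apply Rmult_le_compat_l; [lra|]. apply pow_R1_Rle, M1.
Qed.

Lemma CV_radius_PS_inv (a : nat -> R) :
  Rbar_lt 0 (CV_radius a) -> Rbar_lt 0 (CV_radius (PS_inv a)).
Proof.
  intros H. destruct (CV_radius_geometric_inv a H) as [rho [Hr Ha]].
  apply Rbar_lt_le_trans with (Finite (/ (2 * rho))).
  - simpl. apply Rinv_0_lt_compat. lra.
  - apply CV_radius_geometric; [lra|]. apply PS_inv_bound; [lra | assumption].
Qed.

Lemma CV_radius_near_0 (a : nat -> R) :
  Rbar_lt 0 (CV_radius a) ->
  exists r, 0 < r /\ forall q, Cmod q < r -> Rbar_lt (Cmod q) (CV_radius a).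
Proof.
  intros H. destruct (CV_radius a) as [x| |]; simpl in H.
  - exists x. split; [assumption|]. intros q Hq. exact Hq.
  - exists 1. split; [lra|]. intros; exact I.
  - contradiction.
Qed.

Lemma is_pseries_unique_C (a : nat -> C) (q l l' : C) :
  is_pseries (K := C_AbsRing) (V := C_NormedModule) a q l ->
  is_pseries (K := C_AbsRing) (V := C_NormedModule) a q l' -> l = l'.
Proof. apply filterlim_locally_unique. Qed.

Lemma is_pseries_one_C (q : C) :
  is_pseries (K := C_AbsRing) (V := C_NormedModule)
    (fun n => RtoC (if n then 1 else 0)) q (RtoC 1).
Proof.
  apply is_pseries_C.
  apply filterlim_ext with (fun _ => RtoC 1); [|apply filterlim_const].
  intros n. symmetry. induction n as [|n IH].
  - rewrite sum_O. apply Cmult_1_r.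
  - rewrite sum_Sn, IH, Cmult_0_l. apply Cplus_0_r.
Qed.

(** Near 0 the series of the formal inverse converges to some l, and the Cauchy product gives f(q) l
    = 1. This shows both that f(q) is nonzero and that l is its inverse. *)
Lemma taylor_at_0_inv (f : C -> C) (a : nat -> R) :
  a 0%nat = 1 -> taylor_at_0 f (fun n => RtoC (a n)) ->
  taylor_at_0 (fun q => / f q)%C (fun n => RtoC (PS_inv a n)).
Proof.
  intros H0 Hf.
  assert (Ra := taylor_at_0_CV_radius _ _ Hf).
  assert (Ri := CV_radius_PS_inv _ Ra).
  destruct (CV_radius_near_0 _ Ra) as [r1 [Hr1 K1]].
  destruct (CV_radius_near_0 _ Ri) as [r2 [Hr2 K2]].
  destruct Hf as [r [Hr Hf]].
  exists (Rmin r (Rmin r1 r2)). split.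
  { repeat apply Rmin_glb_lt; assumption. }
  intros q Hq.
  assert (Q : Cmod q < r /\ Cmod q < r1 /\ Cmod q < r2).
  { assert (A := Rmin_l r (Rmin r1 r2)). assert (B := Rmin_r r (Rmin r1 r2)).
    assert (A' := Rmin_l r1 r2). assert (B' := Rmin_r r1 r2). lra. }
  destruct Q as [Q [Q1 Q2]]. specialize (K1 q Q1). specialize (K2 q Q2).
  destruct (ex_series_Cmod _ (ex_series_Cmod_pseries _ _ K2)) as [l Hl].
  apply is_pseries_C in Hl.
  assert (M := is_pseries_mult_C _ _ _ _ _ (Hf q Q) Hl K1 K2).
  assert (E : (f q * l)%C = RtoC 1).
  { apply (is_pseries_unique_C _ _ _ _ M).
    generalize (is_pseries_one_C q). apply is_pseries_ext.
    intros n. now rewrite PS_inv_mult. }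
  assert (Hnz : f q <> RtoC 0).
  { intros Z. rewrite Z, Cmult_0_l in E. apply RtoC_inj in E. lra. }
  replace (/ f q)%C with l; [assumption|].
  rewrite <- (Cmult_1_l l), <- (Cinv_l (f q)), <- Cmult_assoc, E by assumption.
  apply Cmult_1_r.
Qed.

(** * Taylor expansions of q-rationals *)

Lemma taylor_at_0_ext (f g : C -> C) (a b : nat -> C) :
  (forall q, f q = g q) -> (forall n, a n = b n) ->
  taylor_at_0 f a -> taylor_at_0 g b.
Proof.
  intros Hf Ha [r [Hr H]]. exists r. split; [assumption|].
  intros q Hq. rewrite <- Hf. apply is_pseries_ext with (1 := Ha). now apply H.
Qed.

Lemma taylor_at_0_plus (f g : C -> C) (a b : nat -> C) :
  taylor_at_0 f a -> taylor_at_0 g b ->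
  taylor_at_0 (fun q => f q + g q)%C (fun n => a n + b n)%C.
Proof.
  intros [r [Hr Hf]] [s [Hs Hg]]. exists (Rmin r s).
  split; [now apply Rmin_glb_lt|]. intros q Hq.
  assert (Ml := Rmin_l r s). assert (Mr := Rmin_r r s).
  apply (is_pseries_plus (K := C_AbsRing) (V := C_NormedModule));
    [apply Hf | apply Hg]; lra.
Qed.

Lemma taylor_at_0_opp (f : C -> C) (a : nat -> C) :
  taylor_at_0 f a -> taylor_at_0 (fun q => - f q)%C (fun n => - a n)%C.
Proof.
  intros [r [Hr Hf]]. exists r. split; [assumption|]. intros q Hq.
  apply (is_pseries_opp (K := C_AbsRing) (V := C_NormedModule)). now apply Hf.
Qed.

Lemma taylor_at_0_mul_pow (f : C -> C) (a : nat -> R) (k : nat) :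
  taylor_at_0 f (fun n => RtoC (a n)) ->
  taylor_at_0 (fun q => q ^ k * f q)%C (fun n => RtoC (PS_incr_n a k n)).
Proof.
  intros [r [Hr Hf]]. exists r. split; [assumption|]. intros q Hq.
  rewrite <- pow_n_C.
  generalize (is_pseries_incr_n (K := C_AbsRing) (V := C_NormedModule)
    _ k q _ (Hf q Hq)).
  apply is_pseries_ext. intros n. rewrite !PS_incr_n_simplify.
  destruct (Compare_dec.le_lt_dec k n); reflexivity.
Qed.

Definition q_int_coef (c n : nat) : R := if (n <? c)%nat then 1 else 0.

Lemma taylor_at_0_q_int (c : nat) :
  taylor_at_0 (q_int c) (fun n => RtoC (q_int_coef c n)).
Proof.
  induction c as [|c IH].
  (* The zero function is written as 1 - 1, so that its expansion comes from that of the constant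
     1. *)
  - apply taylor_at_0_ext with (fun q : C => RtoC 1 + - RtoC 1)%C
      (fun n : nat => RtoC (if n then 1 else 0)%R + - RtoC (if n then 1 else 0)%R)%C.
    + intros q. apply Cplus_opp_r.
    + intros n. apply Cplus_opp_r.
    + assert (H : taylor_at_0 (fun _ : C => RtoC 1) (fun n => RtoC (if n then 1 else 0))).
      { exists 1. split; [lra|]. intros q _. apply is_pseries_one_C. }
      apply taylor_at_0_plus; [|apply taylor_at_0_opp]; exact H.
  - assert (H : taylor_at_0 (fun _ : C => RtoC 1) (fun n => RtoC (if n then 1 else 0))).
    { exists 1. split; [lra|]. intros q _. apply is_pseries_one_C. }
    generalize (taylor_at_0_plus _ _ _ _ IH (taylor_at_0_mul_pow _ _ c H)).
    apply taylor_at_0_ext.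
    + intros q. simpl. now rewrite Cmult_1_r.
    + intros n. rewrite <- RtoC_plus. f_equal. unfold q_int_coef.
      rewrite PS_incr_n_simplify.
      destruct (Compare_dec.le_lt_dec c n); destruct (Nat.ltb_spec n c);
        destruct (Nat.ltb_spec n (S c)); try lia.
      * replace (n - c)%nat with 0%nat by lia. ring.
      * destruct (n - c)%nat eqn:E; [lia|]. ring.
      * unfold zero; simpl. ring.
Qed.

Fixpoint hj_coef (c : nat) (l : list nat) : nat -> R :=
  match l with
  | nil => q_int_coef c
  | d :: l' => fun n => q_int_coef c n - PS_incr_n (PS_inv (hj_coef d l')) (c - 1) n
  end.

Lemma hj_coef_cons (c d : nat) (l : list nat) (n : nat) :
  hj_coef c (d :: l) n =
  q_int_coef c n - PS_incr_n (PS_inv (hj_coef d l)) (c - 1) n.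
Proof. reflexivity. Qed.

(** For c >= 2 the subtracted series is shifted by c - 1 > 0 and leaves the constant term alone.
    This supplies the normalization that [PS_inv] needs at every digit after the first. *)
Lemma hj_coef_0 (c : nat) (l : list nat) : (2 <= c)%nat -> hj_coef c l 0%nat = 1.
Proof.
  intros Hc. destruct l as [|d l]; simpl; unfold q_int_coef.
  - destruct (Nat.ltb_spec 0 c); [reflexivity | lia].
  - rewrite PS_incr_n_simplify.
    destruct (Compare_dec.le_lt_dec (c - 1) 0); [lia|].
    destruct (Nat.ltb_spec 0 c); [|lia]. unfold zero; simpl. ring.
Qed.

Lemma taylor_at_0_hj_q (l : list nat) :
  List.Forall (fun d => (2 <= d)%nat) l -> forall c,
  taylor_at_0 (hj_q c l) (fun n => RtoC (hj_coef c l n)).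
Proof.
  induction 1 as [|d l Hd Hl IH]; intros c.
  - apply taylor_at_0_q_int.
  - generalize (taylor_at_0_plus _ _ _ _ (taylor_at_0_q_int c)
      (taylor_at_0_opp _ _ (taylor_at_0_mul_pow _ _ (c - 1)
        (taylor_at_0_inv _ _ (hj_coef_0 d l Hd) (IH d))))).
    apply taylor_at_0_ext.
    + intros q. reflexivity.
    + intros n. simpl. now rewrite RtoC_minus.
Qed.

(** * Hirzebruch-Jung expansions of rationals *)

Lemma hj_gt_1 (l : list nat) :
  List.Forall (fun d => (2 <= d)%nat) l -> forall c, (2 <= c)%nat -> 1 < hj c l.
Proof.
  induction 1 as [|d l Hd Hl IH]; intros c Hc; simpl; apply le_INR in Hc;
    simpl in Hc; [lra|].
  specialize (IH d Hd).
  assert (/ hj d l < 1) by (rewrite <- Rinv_1; apply Rinv_lt_contravar; lra).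
  lra.
Qed.

(* The expansion of p / n is obtained by Euclidean division rounding upwards:
   p = c n - r with 0 <= r < n, so that p / n = c - 1 / (n / r). *)
Lemma hj_exists (n : nat) : forall p, (0 < n)%nat -> (0 < p)%nat ->
  exists c l, hj_valid c l /\ hj c l = INR p / INR n /\ ((n < p)%nat -> (2 <= c)%nat).
Proof.
  induction n as [n IH] using lt_wf_ind. intros p Hn Hp.
  set (c := ((p + n - 1) / n)%nat).
  assert (D := Nat.div_mod_eq (p + n - 1) n). fold c in D.
  assert (B := Nat.mod_upper_bound (p + n - 1) n ltac:(lia)).
  assert (Hc : (1 <= c)%nat) by (destruct c; lia).
  assert (Hc2 : (n < p)%nat -> (2 <= c)%nat) by (destruct c as [|[|c']]; lia).
  assert (Nn : INR n <> 0) by (apply not_0_INR; lia).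
  destruct (Nat.eq_dec (n * c) p) as [E|E].
  - exists c, nil. repeat split; auto. simpl. rewrite <- E, mult_INR. now field.
  - destruct (IH (n * c - p)%nat ltac:(lia) n ltac:(lia) Hn)
      as [d [l [[_ Hl] [V Hd]]]].
    exists c, (d :: l). repeat split; auto.
    { constructor; [apply Hd; lia | assumption]. }
    simpl. rewrite V.
    assert (Nr : INR (n * c - p) <> 0) by (apply not_0_INR; lia).
    replace (/ (INR n / INR (n * c - p))) with (INR (n * c - p) / INR n)
      by now field.
    rewrite minus_INR, mult_INR by lia. now field.
Qed.

Lemma hj_exists_Q (x : Q) :
  0 < Q2R x -> exists c l, hj_valid c l /\ Q2R x = hj c l.
Proof.
  destruct x as [a b]. unfold Q2R. simpl. intros H.
  assert (Hb : 0 < IZR (Zpos b)) by (apply IZR_lt; lia).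
  assert (Ha : (0 < a)%Z).
  { apply lt_IZR. apply Rmult_lt_reg_r with (/ IZR (Zpos b));
      [now apply Rinv_0_lt_compat | lra]. }
  destruct (hj_exists (Pos.to_nat b) (Z.to_nat a) ltac:(lia) ltac:(lia))
    as [c [l [V [E _]]]].
  exists c, l. split; [assumption|]. rewrite E.
  rewrite !INR_IZR_INZ, Z2Nat.id, positive_nat_Z by lia. reflexivity.
Qed.

Lemma hj_unfold (c : nat) (l : list nat) :
  List.Forall (fun d => (2 <= d)%nat) l ->
  (l = nil /\ hj c l = INR c) \/
  exists d l', l = d :: l' /\ (2 <= d)%nat /\ List.Forall (fun d => (2 <= d)%nat) l' /\
    1 < hj d l' /\ hj c l = INR c - / hj d l'.
Proof.
  intros H. destruct H as [|d l Hd Hl]; [now left|]. right.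
  exists d, l. repeat split; auto. now apply hj_gt_1.
Qed.

(** A nonempty tail has value greater than 1, so the whole expansion lies strictly between c - 1 and
    c. A value strictly between consecutive integers thus forces the first digit and determines the
    value of the tail. *)
Lemma hj_first_digit (n c : nat) (l : list nat) :
  List.Forall (fun d => (2 <= d)%nat) l -> INR n < hj c l < INR (S n) ->
  c = S n /\ exists d l', l = d :: l' /\ (2 <= d)%nat /\
    List.Forall (fun d => (2 <= d)%nat) l' /\ hj d l' = / (INR (S n) - hj c l).
Proof.
  intros Hl [H1 H2]. destruct (hj_unfold c l Hl) as [[_ E]|[d [l' [El [Hd [Hl' [G E]]]]]]].
  - rewrite E in H1, H2. apply INR_lt in H1, H2. lia.
  - assert (P : 0 < / hj d l') by (apply Rinv_0_lt_compat; lra).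
    assert (L : / hj d l' < 1) by (rewrite <- Rinv_1; apply Rinv_lt_contravar; lra).
    assert (A : (n < c)%nat) by (apply INR_lt; lra).
    assert (B : (c < S (S n))%nat) by (apply INR_lt; rewrite S_INR; lra).
    assert (Ec : c = S n) by lia. split; [assumption|].
    exists d, l'. repeat split; auto.
    rewrite E, Ec. replace (INR (S n) - (INR (S n) - / hj d l')) with (/ hj d l') by ring.
    now rewrite Rinv_inv.
Qed.

(** * The RNA numbers and the candidate coefficients *)

(* The coefficients 1, 1, 1, 2, 4, 8, 17, ... of S = 1 + x S + x^2 (S^2 - S); they
   count RNA secondary structures. *)
Definition rna_step (f : nat -> R) (n : nat) : R :=
  match n with
  | O => 1
  | S O => f 0%nat
  | S (S m) => f (S m) - f m + PS_mult f f m
  end.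

Definition rna : nat -> R := fix_seq rna_step.

Lemma rna_step_causal : causal rna_step.
Proof.
  intros f g [|[|n]] H; simpl; [reflexivity | apply H; lia |].
  rewrite !H by lia. f_equal. apply sum_eq. intros k Hk. rewrite !H by lia.
  reflexivity.
Qed.

Lemma rna_0 : rna 0 = 1.
Proof. reflexivity. Qed.

Lemma rna_1 : rna 1 = 1.
Proof. reflexivity. Qed.

Lemma rna_SS (n : nat) : rna (S (S n)) = rna (S n) - rna n + PS_mult rna rna n.
Proof. unfold rna at 1. now rewrite fix_seq_eq by apply rna_step_causal. Qed.

Lemma sum_nonneg (u : nat -> R) (n : nat) :
  (forall k, (k <= n)%nat -> 0 <= u k) -> 0 <= sum_f_R0 u n.
Proof.
  intros H. rewrite <- (Rmult_0_l (INR (S n))), <- sum_cte.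
  now apply sum_Rle.
Qed.

Lemma PS_mult_one_l (a : nat -> R) (n : nat) :
  PS_mult (fun k => if k then 1 else 0) a n = a n.
Proof.
  destruct n as [|n].
  - unfold PS_mult. simpl. ring.
  - rewrite PS_mult_S, sum_eq_R0; [ring|]. intros; ring.
Qed.

(** The negative term [- rna n] of the recurrence is compensated by the term [rna 0 * rna n] of the
    convolution. *)
Lemma rna_pos (n : nat) : 0 <= rna n.
Proof.
  induction n as [[|[|n]] IH] using lt_wf_ind; [rewrite rna_0; lra | rewrite rna_1; lra |].
  rewrite rna_SS.
  assert (H : rna n <= PS_mult rna rna n).
  { destruct n as [|n].
    - unfold PS_mult. simpl. rewrite rna_0. lra.
    - rewrite PS_mult_S, rna_0.
      assert (0 <= sum_f_R0 (fun k => rna (S k) * rna (n - k)%nat) n); [|lra].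
      apply sum_nonneg. intros k Hk. apply Rmult_le_pos; apply IH; lia. }
  specialize (IH (S n) ltac:(lia)). lra.
Qed.

(* The expansions of 1 / [phi^2]_q, of [phi^2]_q = [3]_q - q^2 / [phi^2]_q and of
   [phi]_q = [2]_q - q / [phi^2]_q. *)
Definition golden_sq_inv (n : nat) : R := (-1) ^ n * rna n.

Definition golden_sq_coef (n : nat) : R :=
  q_int_coef 3 n - PS_incr_n golden_sq_inv 2 n.

Definition golden_coef (n : nat) : R :=
  q_int_coef 2 n - PS_incr_n golden_sq_inv 1 n.

Lemma golden_sq_inv_mult (n : nat) :
  PS_mult golden_sq_inv golden_sq_inv n = (-1) ^ n * PS_mult rna rna n.
Proof.
  unfold PS_mult. rewrite scal_sum. apply sum_eq. intros k Hk.
  unfold golden_sq_inv.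
  assert (E : (-1) ^ n = (-1) ^ k * (-1) ^ (n - k))
    by (rewrite <- pow_add; f_equal; lia).
  rewrite E. ring.
Qed.

Lemma golden_sq_coef_SS (n : nat) :
  golden_sq_coef (S (S n)) = (if n then 1 else 0) - golden_sq_inv n.
Proof.
  unfold golden_sq_coef, q_int_coef. simpl PS_incr_n. now destruct n.
Qed.

(** With W the series of [golden_sq_inv], this is W (1 + q + q^2 - q^2 W) = 1 read coefficientwise:
    the RNA recurrence with alternating signs is the recurrence of a formal inverse. *)
Lemma golden_sq_inv_S (n : nat) :
  golden_sq_inv (S n) =
  - sum_f_R0 (fun k => golden_sq_coef (S k) * golden_sq_inv (n - k)%nat) n.
Proof.
  assert (E1 : golden_sq_coef 1 = 1)
    by (unfold golden_sq_coef, q_int_coef; simpl; unfold zero; simpl; ring).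
  destruct n as [|n].
  - simpl. rewrite E1. unfold golden_sq_inv. rewrite rna_0, rna_1. simpl. ring.
  - rewrite decomp_sum by lia. simpl pred. rewrite E1.
    (* From index 2 on the factor is the series of 1 - W, so the remaining sum splits into the
       convolutions 1 * W and W * W. *)
    rewrite (sum_eq _ (fun k => (if k then 1 else 0) * golden_sq_inv (n - k)%nat
      - golden_sq_inv k * golden_sq_inv (n - k)%nat)).
    2:{ intros k Hk. rewrite golden_sq_coef_SS. simpl Nat.sub. ring. }
    rewrite minus_sum.
    change (golden_sq_inv (S (S n)) = - (1 * golden_sq_inv (S n) +
      (PS_mult (fun k => if k then 1 else 0) golden_sq_inv n
       - PS_mult golden_sq_inv golden_sq_inv n))).
    rewrite PS_mult_one_l, golden_sq_inv_mult. unfold golden_sq_inv.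
    rewrite rna_SS. simpl. ring.
Qed.

(** * Stabilization of the coefficients near the golden ratio *)

Lemma sqrt_5_bounds : sqrt 5 * sqrt 5 = 5 /\ 2.23 < sqrt 5 < 2.24.
Proof.
  assert (E : sqrt 5 * sqrt 5 = 5) by (apply sqrt_sqrt; lra).
  assert (P := sqrt_pos 5). split; [assumption|]. split; nra.
Qed.

(** Multiplication by q^j gains j coefficients of agreement; this gain drives the induction on the
    number of stable coefficients. *)
Lemma PS_incr_n_agree (a b : nat -> R) (m j k : nat) :
  (forall i, (i <= m)%nat -> a i = b i) -> (k <= m + j)%nat ->
  PS_incr_n a j k = PS_incr_n b j k.
Proof.
  intros H Hk. rewrite !PS_incr_n_simplify.
  destruct (Compare_dec.le_lt_dec j k); [apply H; lia | reflexivity].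
Qed.

Lemma PS_inv_golden_sq (c : nat) (l : list nat) (m : nat) :
  (forall k, (k <= m)%nat -> hj_coef c l k = golden_sq_coef k) ->
  forall k, (k <= m)%nat -> PS_inv (hj_coef c l) k = golden_sq_inv k.
Proof.
  intros H. apply (PS_inv_agree golden_sq_coef).
  - unfold golden_sq_inv. rewrite rna_0. simpl. ring.
  - apply golden_sq_inv_S.
  - assumption.
Qed.

(** The difference of the inverses is (b - a) / (a b), and a b exceeds 0.2 * 0.3 = 0.06. *)
Lemma inv_lipschitz (a b eps : R) :
  0.2 < a -> 0.3 < b -> Rabs (a - b) < 0.06 * eps -> Rabs (/ a - / b) < eps.
Proof.
  intros Ha Hb H.
  replace (/ a - / b) with ((b - a) * / (a * b)) by (field; lra).
  rewrite Rabs_mult, Rabs_minus_sym, (Rabs_pos_eq (/ _))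
    by (left; apply Rinv_0_lt_compat; nra).
  apply Rmult_lt_reg_r with (a * b); [nra|].
  rewrite Rmult_assoc, Rinv_l by nra.
  assert (P := Rabs_pos (a - b)). assert (Q : 0.06 < a * b) by nra. nra.
Qed.

(* The map x |-> 1 / (3 - x) fixes phi^2, so that every
   x close to phi^2 has first digit 3 and remainder again close to phi^2. *)
Lemma golden_sq_stable (m : nat) : exists eps, 0 < eps /\
  forall c l, (2 <= c)%nat -> List.Forall (fun d => (2 <= d)%nat) l ->
  Rabs (hj c l - (3 + sqrt 5) / 2) < eps ->
  forall k, (k <= m)%nat -> hj_coef c l k = golden_sq_coef k.
Proof.
  destruct sqrt_5_bounds as [E B].
  induction m as [|m [eps [He IH]]].
  (* Every expansion with first digit at least 2 has constant term 1, so any radius serves here. *)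
  - exists 1. split; [lra|]. intros c l Hc _ _ k Hk.
    replace k with 0%nat by lia. rewrite hj_coef_0 by assumption.
    unfold golden_sq_coef, q_int_coef. simpl. unfold zero; simpl. ring.
  (* Within 0.1 of phi^2 a value x lies in (2, 3) and 3 - x exceeds 0.2; the factor 0.06 is that of
     [inv_lipschitz]. *)
  - exists (Rmin 0.1 (0.06 * eps)). split; [apply Rmin_glb_lt; lra|].
    intros c l Hc Hl Hx k Hk.
    assert (X1 := Rlt_le_trans _ _ _ Hx (Rmin_l _ _)).
    assert (X2 := Rlt_le_trans _ _ _ Hx (Rmin_r _ _)). clear Hx.
    assert (X := Rabs_def2 _ _ X1).
    destruct (hj_first_digit 2 c l Hl) as [Ec [d [l' [El [Hd [Hl' V]]]]]].
    { simpl. lra. }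
    subst c l. rewrite hj_coef_cons. unfold golden_sq_coef. f_equal.
    (* The digit 3 shifts by 2, so agreement up to m yields agreement up to m + 2, which covers m +
       1. *)
    apply PS_incr_n_agree with m; [|lia].
    apply PS_inv_golden_sq. apply (IH d l' Hd Hl').
    rewrite V. replace ((3 + sqrt 5) / 2) with (/ (3 - (3 + sqrt 5) / 2)).
    + replace (INR 3) with 3 by (simpl; ring).
      apply inv_lipschitz; try lra.
      rewrite Rabs_minus_sym in X2.
      match goal with |- Rabs ?u < _ => replace u with
        ((3 + sqrt 5) / 2 - hj 3 (d :: l')) by ring end.
      exact X2.
    + apply Rmult_eq_reg_l with (3 - (3 + sqrt 5) / 2); [|lra].
      rewrite Rinv_r by lra. nra.
Qed.

(** Since phi = 2 - 1 / phi^2, an expansion with value near phi has first digit 2 and a tail with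
    value near phi^2, to which [golden_sq_stable] applies. *)
Lemma golden_stable (m : nat) : exists eps, 0 < eps /\
  forall c l, hj_valid c l -> Rabs (hj c l - golden_ratio) < eps ->
  forall k, (k <= m)%nat -> hj_coef c l k = golden_coef k.
Proof.
  destruct sqrt_5_bounds as [E B].
  destruct (golden_sq_stable m) as [eps [He IH]].
  exists (Rmin 0.1 (0.06 * eps)). split; [apply Rmin_glb_lt; lra|].
  intros c l [_ Hl] Hx k Hk. unfold golden_ratio in Hx.
  assert (X1 := Rlt_le_trans _ _ _ Hx (Rmin_l _ _)).
  assert (X2 := Rlt_le_trans _ _ _ Hx (Rmin_r _ _)). clear Hx.
  assert (X := Rabs_def2 _ _ X1).
  destruct (hj_first_digit 1 c l Hl) as [Ec [d [l' [El [Hd [Hl' V]]]]]].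
  { simpl. lra. }
  subst c l. rewrite hj_coef_cons. unfold golden_coef. f_equal.
  apply PS_incr_n_agree with m; [|lia].
  apply PS_inv_golden_sq. apply (IH d l' Hd Hl').
  rewrite V. replace ((3 + sqrt 5) / 2) with (/ (2 - (1 + sqrt 5) / 2)).
  - replace (INR 2) with 2 by (simpl; ring).
    apply inv_lipschitz; try lra.
    rewrite Rabs_minus_sym in X2.
    match goal with |- Rabs ?u < _ => replace u with
      ((1 + sqrt 5) / 2 - hj 2 (d :: l')) by ring end.
    exact X2.
  - apply Rmult_eq_reg_l with (2 - (1 + sqrt 5) / 2); [|lra].
    rewrite Rinv_r by lra. nra.
Qed.

Lemma golden_q_rational (m : nat) : exists eps, 0 < eps /\
  forall x : Q, Rabs (Q2R x - golden_ratio) < eps ->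
  (exists a, q_rational_taylor x a) /\
  forall a, q_rational_taylor x a -> a m = RtoC (golden_coef m).
Proof.
  destruct sqrt_5_bounds as [E B].
  destruct (golden_stable m) as [eps [He H]].
  (* The bound 1 keeps x positive, so that it has an expansion. *)
  exists (Rmin 1 eps). split; [apply Rmin_glb_lt; lra|]. intros x Hx.
  assert (X1 := Rlt_le_trans _ _ _ Hx (Rmin_l _ _)).
  assert (X2 := Rlt_le_trans _ _ _ Hx (Rmin_r _ _)).
  apply Rabs_def2 in X1. unfold golden_ratio in X1.
  split.
  - destruct (hj_exists_Q x) as [c [l [V Ex]]]; [lra|].
    exists (fun n => RtoC (hj_coef c l n)), c, l. repeat split; try apply V; auto.
    apply taylor_at_0_hj_q, V.
  - intros a [c [l [V [Ex T]]]].
    rewrite (taylor_at_0_unique _ _ _ T (taylor_at_0_hj_q l (proj2 V) c)).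
    f_equal. apply H; auto. now rewrite <- Ex.
Qed.

(** * The coefficients of the q-deformed golden ratio *)

Lemma Q_dense (x : R) (n : nat) : exists y : Q, Rabs (Q2R y - x) <= / INR (S n).
Proof.
  exists (Qmake (up (x * INR (S n))) (Pos.of_succ_nat n)).
  destruct (archimed (x * INR (S n))) as [A1 A2].
  assert (P : 0 < INR (S n)) by (apply lt_0_INR; lia).
  unfold Q2R. cbn [Qnum Qden].
  replace (IZR (Zpos (Pos.of_succ_nat n))) with (INR (S n))
    by (rewrite INR_IZR_INZ; f_equal; lia).
  assert (I : 0 < / INR (S n)) by now apply Rinv_0_lt_compat.
  set (u := IZR (up (x * INR (S n)))) in *.
  replace (u * / INR (S n) - x) with ((u - x * INR (S n)) * / INR (S n))
    by (field; lra).
  rewrite Rabs_pos_eq by (apply Rmult_le_pos; lra).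
  rewrite <- (Rmult_1_l (/ INR (S n))) at 2. apply Rmult_le_compat_r; lra.
Qed.

Lemma Q_seq_lim (x : R) : exists xs : nat -> Q, is_lim_seq (fun n => Q2R (xs n)) x.
Proof.
  exists (fun n => proj1_sig (constructive_indefinite_description _ (Q_dense x n))).
  apply is_lim_seq_spec. intros eps.
  destruct (archimed_cor1 eps (cond_pos eps)) as [N [HN N0]].
  exists N. intros n Hn.
  destruct (constructive_indefinite_description _ (Q_dense x n)) as [y Hy]. simpl.
  apply Rle_lt_trans with (1 := Hy). apply Rle_lt_trans with (2 := HN).
  apply Rinv_le_contravar; [apply lt_0_INR; lia | apply le_INR; lia].
Qed.

Lemma golden_eventually (xs : nat -> Q) (m : nat) :
  is_lim_seq (fun n => Q2R (xs n)) golden_ratio ->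
  eventually (fun n => (exists a, q_rational_taylor (xs n) a) /\
    forall a, q_rational_taylor (xs n) a -> a m = RtoC (golden_coef m)).
Proof.
  intros L. destruct (golden_q_rational m) as [eps [He H]].
  apply is_lim_seq_spec in L. generalize (L (mkposreal eps He)).
  apply filter_imp. intros n. apply H.
Qed.

Lemma is_q_real_golden : is_q_real golden_ratio (fun n => RtoC (golden_coef n)).
Proof.
  intros xs L k. generalize (golden_eventually xs k L).
  apply filter_imp. intros n [[a Ha] H]. exists a. auto.
Qed.

(** The sequence chosen by [epsilon] satisfies [is_q_real], which speaks of all rational sequences
    tending to phi. Taking one such sequence and a large enough index, its coefficient k equals both
    sides. *)
Lemma q_real_golden (k : nat) : q_real golden_ratio k = RtoC (golden_coef k).
Proof.
  assert (S : is_q_real golden_ratio (q_real golden_ratio)).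
  { unfold q_real. apply epsilon_spec. eexists. apply is_q_real_golden. }
  destruct (Q_seq_lim golden_ratio) as [xs L].
  destruct (filter_and _ _ (S xs L k) (golden_eventually xs k L)) as [N H].
  destruct (H N (le_n N)) as [[a [Ha Ea]] [_ U]].
  rewrite <- Ea. now apply U.
Qed.

(** * Convergence of the RNA series at R *)

Lemma PS_mult_scaled (a b : nat -> R) (x : R) (n : nat) :
  PS_mult (fun k => a k * x ^ k) (fun k => b k * x ^ k) n = PS_mult a b n * x ^ n.
Proof.
  unfold PS_mult. rewrite Rmult_comm, scal_sum. apply sum_eq. intros k Hk.
  assert (E : x ^ n = x ^ k * x ^ (n - k)) by (rewrite <- pow_add; f_equal; lia).
  rewrite E. ring.
Qed.

(** The left side collects the products u i * u j with i + j <= n, the right side those with i, j <=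
    n. *)
Lemma sum_PS_mult_le (u : nat -> R) (n : nat) :
  (forall k, 0 <= u k) -> sum_f_R0 (PS_mult u u) n <= sum_f_R0 u n * sum_f_R0 u n.
Proof.
  intros H. destruct n as [|n].
  - unfold PS_mult. simpl. lra.
  - rewrite cauchy_finite by lia. fold (PS_mult u u).
    match goal with |- ?a <= ?b + ?c => change (a <= a + c) end.
    match goal with |- ?a <= ?a + ?c => assert (0 <= c) end; [|lra].
    apply sum_nonneg. intros k _. apply sum_nonneg. intros l _.
    now apply Rmult_le_pos.
Qed.

Definition rna_sum (x : R) (n : nat) : R := sum_f_R0 (fun k => rna k * x ^ k) n.

(** An exact truncation of S = 1 + x S + x^2 (S^2 - S). It serves twice: to bound the partial sums
    and, in the limit, to obtain the quadratic equation. *)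
Lemma rna_sum_SS (x : R) (n : nat) :
  rna_sum x (S (S n)) = 1 + x * rna_sum x (S n) + x ^ 2 *
    (sum_f_R0 (PS_mult (fun k => rna k * x ^ k) (fun k => rna k * x ^ k)) n
     - rna_sum x n).
Proof.
  induction n as [|n IH].
  - unfold rna_sum, PS_mult. simpl. rewrite rna_SS, rna_0, rna_1.
    unfold PS_mult. simpl. rewrite rna_0. ring.
  - assert (U : forall k, rna_sum x (S k) = rna_sum x k + rna (S k) * x ^ S k)
      by reflexivity.
    rewrite U, IH at 1. rewrite (U (S n)), tech5, PS_mult_scaled, (rna_SS (S n)), (U n).
    simpl pow. ring.
Qed.

(** The map t |-> 1 + x t + x^2 (t^2 - t) is increasing for t >= 1, so a point that it does not
    raise bounds all partial sums, by induction on two consecutive ones. *)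
Lemma rna_sum_bound (x t : R) : 0 <= x -> 1 <= t ->
  1 + x * t + x ^ 2 * (t ^ 2 - t) <= t -> forall n, rna_sum x n <= t.
Proof.
  intros Hx Ht Hfix.
  assert (Hpos : forall k, 0 <= rna k * x ^ k).
  { intros k. apply Rmult_le_pos; [apply rna_pos | now apply pow_le]. }
  assert (X2 : 0 <= x ^ 2) by now apply pow_le.
  assert (H0 : rna_sum x 0 <= t) by (unfold rna_sum; simpl; rewrite rna_0; lra).
  assert (H1 : rna_sum x 1 <= t).
  { unfold rna_sum; simpl; rewrite rna_0, rna_1.
    assert (0 <= x ^ 2 * (t ^ 2 - t)) by (apply Rmult_le_pos; nra). nra. }
  enough (H : forall n, rna_sum x n <= t /\ rna_sum x (S n) <= t) by (intros n; apply H).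
  induction n as [|n [IH1 IH2]]; [now split|]. split; [assumption|].
  rewrite rna_sum_SS.
  assert (C := sum_PS_mult_le _ n Hpos). fold (rna_sum x n) in C.
  (* The lower bound 1 places p where p^2 - p is increasing, so that p <= t gives p^2 - p <= t^2 -
     t. *)
  assert (P1 : 1 <= rna_sum x n).
  { clear -Hpos. induction n as [|n IH].
    - unfold rna_sum. simpl. rewrite rna_0. lra.
    - unfold rna_sum in *. rewrite tech5. specialize (Hpos (S n)). lra. }
  set (p := rna_sum x n) in *.
  assert (Q : sum_f_R0 (PS_mult (fun k => rna k * x ^ k) (fun k => rna k * x ^ k)) n - p
    <= t ^ 2 - t) by nra.
  apply (Rmult_le_compat_l (x ^ 2)) in Q; [|assumption].
  apply (Rmult_le_compat_l x) in IH2; [|assumption]. lra.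
Qed.

Lemma ex_series_rna : ex_series (fun n => rna n * ((3 - sqrt 5) / 2) ^ n).
Proof.
  destruct sqrt_5_bounds as [E B]. set (x := (3 - sqrt 5) / 2).
  assert (Hx : 0.38 <= x <= 0.39) by (unfold x; lra).
  assert (Ex : x * x = 3 * x - 1) by (unfold x; nra).
  (* The bound 3 - x equals 1 / x, because x^2 = 3 x - 1; it is a fixed point of the map in
     [rna_sum_bound]. *)
  destruct (ex_finite_lim_seq_incr (rna_sum x) (3 - x)) as [l Hl].
  - intros n. unfold rna_sum. rewrite tech5.
    assert (0 <= rna (S n) * x ^ S n); [|lra].
    apply Rmult_le_pos; [apply rna_pos | apply pow_le; lra].
  - apply rna_sum_bound; [lra | lra |].
    replace (x ^ 2) with (3 * x - 1) by (simpl; lra).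
    replace ((3 - x) ^ 2) with (8 - 3 * x) by (simpl; lra). nra.
  - exists l. apply is_lim_seq_ext with (2 := Hl).
    intros n. symmetry. apply sum_n_Reals.
Qed.

(** * Divergence of the RNA series beyond R *)

Lemma PSeries_rna_quadratic (x : R) :
  Rbar_lt (Rabs x) (CV_radius rna) ->
  PSeries rna x = 1 + x * PSeries rna x + x ^ 2 * (PSeries rna x ^ 2 - PSeries rna x).
Proof.
  intros H. assert (A := CV_disk_inside _ _ H).
  assert (S := PSeries_correct _ _ (CV_radius_inside _ _ H)).
  apply is_pseries_R in S. set (l := PSeries rna x) in *.
  assert (M := is_series_mult _ _ _ _ S S A A).
  assert (L : is_lim_seq (rna_sum x) l).
  { apply is_lim_seq_ext with (2 := S). intros n. apply sum_n_Reals. }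
  assert (L2 : is_lim_seq (fun n => sum_f_R0
    (PS_mult (fun k => rna k * x ^ k) (fun k => rna k * x ^ k)) n) (l * l)).
  { apply is_lim_seq_ext with (2 := M). intros n. apply sum_n_Reals. }
  assert (L3 := proj1 (is_lim_seq_incr_1 _ _) L).
  assert (L4 := proj1 (is_lim_seq_incr_1 _ _) L3).
  apply (is_lim_seq_ext _ _ _ (rna_sum_SS x)) in L4.
  assert (L5 : is_lim_seq (fun n => 1 + x * rna_sum x (Datatypes.S n) + x ^ 2 *
    (sum_f_R0 (PS_mult (fun k => rna k * x ^ k) (fun k => rna k * x ^ k)) n
     - rna_sum x n)) (1 + x * l + x ^ 2 * (l * l - l))).
  { apply is_lim_seq_plus'.
    - apply is_lim_seq_plus'; [apply is_lim_seq_const|].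
      apply is_lim_seq_mult'; [apply is_lim_seq_const | exact L3].
    - apply is_lim_seq_mult'; [apply is_lim_seq_const|].
      apply is_lim_seq_minus'; assumption. }
  apply is_lim_seq_unique in L4. apply is_lim_seq_unique in L5.
  rewrite L4 in L5. injection L5 as L5. rewrite L5 at 1. ring.
Qed.

Lemma CV_radius_rna : Rbar_le (CV_radius rna) ((3 - sqrt 5) / 2).
Proof.
  destruct sqrt_5_bounds as [E B].
  destruct (Rbar_le_lt_dec (CV_radius rna) ((3 - sqrt 5) / 2)) as [H|H];
    [assumption|exfalso].
  (* The roots of 1 - 3 x + x^2 are R and 1 / R > 1, so staying below 1 keeps this factor
     negative. *)
  assert (X : exists x, (3 - sqrt 5) / 2 < x < 1 /\ Rbar_lt x (CV_radius rna)).
  { destruct (CV_radius rna) as [r| |]; simpl in H.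
    - exists (((3 - sqrt 5) / 2 + Rmin r 1) / 2).
      assert (Ml := Rmin_l r 1). assert (Mr := Rmin_r r 1).
      assert (Mg : (3 - sqrt 5) / 2 < Rmin r 1) by (apply Rmin_glb_lt; lra).
      simpl. lra.
    - exists (1 / 2). simpl. split; [lra | exact I].
    - contradiction. }
  destruct X as [x [Hx Hc]].
  assert (Q := PSeries_rna_quadratic x).
  rewrite Rabs_pos_eq in Q by lra. specialize (Q Hc).
  set (s := PSeries rna x) in *.
  (* Completing the square in x^2 s^2 - (1 - x + x^2) s + 1 = 0: the right side is (1 - x + x^2)^2 -
     (2 x)^2, factored. *)
  assert (D : (2 * x ^ 2 * s - (1 - x + x ^ 2)) ^ 2
    = (1 - 3 * x + x ^ 2) * (1 + x + x ^ 2)) by (simpl in *; nra).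
  assert (D1 : 1 - 3 * x + x ^ 2 < 0) by (simpl; nra).
  assert (D2 : 0 < 1 + x + x ^ 2) by (simpl; nra).
  assert (D3 := pow2_ge_0 (2 * x ^ 2 * s - (1 - x + x ^ 2))). nra.
Qed.

(** * From the RNA series to the golden ratio *)

(** Beyond [2]_q = 1 + q only - q W contributes, so from index 2 on the absolute values are RNA
    numbers shifted by one. *)
Lemma Rabs_golden_coef_SS (n : nat) :
  Rabs (golden_coef (S (S n))) = rna (S n).
Proof.
  unfold golden_coef, q_int_coef. simpl PS_incr_n. unfold golden_sq_inv.
  simpl Nat.ltb. rewrite Rminus_0_l, Rabs_Ropp, Rabs_mult, pow_1_abs, Rmult_1_l.
  apply Rabs_pos_eq, rna_pos.
Qed.

Lemma golden_coef_ex_pseries :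
  ex_pseries (K := C_AbsRing) (V := C_NormedModule)
    (fun n => RtoC (golden_coef n)) (RtoC ((3 - sqrt 5) / 2)).
Proof.
  destruct sqrt_5_bounds as [E B].
  assert (S : ex_series (fun n =>
    Cmod (RtoC (golden_coef n) * RtoC ((3 - sqrt 5) / 2) ^ n))).
  { do 2 apply ex_series_incr_1.
    (* The factor R makes up for the shift: the coefficient of index n + 2 has absolute value
       [rna (S n)]. *)
    assert (H := ex_series_scal_l ((3 - sqrt 5) / 2) _
      (proj1 (ex_series_incr_1 _) ex_series_rna)).
    revert H. apply ex_series_ext. intros n.
    rewrite Cmod_mult, Cmod_pow, !Cmod_R, Rabs_golden_coef_SS.
    rewrite Rabs_pos_eq by lra.
    change scal with Rmult. simpl. ring. }
  destruct (ex_series_Cmod _ S) as [l Hl]. exists l. now apply is_pseries_C.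
Qed.

(** Convergence at q makes the terms tend to 0, hence also [rna n] times |q|^n, which is impossible
    outside the disc of convergence of the RNA series. *)
Lemma golden_coef_Cmod_le (q : C) :
  ex_pseries (K := C_AbsRing) (V := C_NormedModule)
    (fun n => RtoC (golden_coef n)) q -> Cmod q <= (3 - sqrt 5) / 2.
Proof.
  intros [l Hl]. apply is_pseries_C in Hl.
  destruct sqrt_5_bounds as [E B].
  destruct (Rle_lt_dec (Cmod q) ((3 - sqrt 5) / 2)) as [H|H]; [assumption|].
  exfalso.
  assert (L := C_ex_series_lim_0 _ (ex_intro _ l Hl)).
  apply is_lim_seq_incr_1 in L. apply is_lim_seq_incr_1 in L.
  (* Dividing by |q| undoes the shift of index between the two series. *)
  apply (is_lim_seq_scal_l _ (/ Cmod q)) in L. simpl Rbar_mult in L.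
  rewrite Rmult_0_r in L.
  apply (CV_disk_outside rna (Cmod q)).
  - apply Rbar_le_lt_trans with (1 := CV_radius_rna). simpl.
    rewrite Rabs_pos_eq; [assumption | apply Cmod_ge_0].
  - apply is_lim_seq_incr_1. revert L. apply is_lim_seq_ext. intros n.
    rewrite Cmod_mult, Cmod_pow, Cmod_R, Rabs_golden_coef_SS.
    simpl. field. lra.
Qed.

Theorem proposition3p1 :
  C_CV_radius (q_real golden_ratio) = Finite ((3 - sqrt 5) / 2).
Proof.
  apply is_lub_Rbar_unique. split.
  - intros r [q [<- [l H]]]. apply golden_coef_Cmod_le. exists l. revert H.
    apply is_pseries_ext. apply q_real_golden.
  (* The supremum is attained, at q = R itself. *)
  - intros b Hb. apply Hb. exists (RtoC ((3 - sqrt 5) / 2)). split.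
    + rewrite Cmod_R. apply Rabs_pos_eq. destruct sqrt_5_bounds. lra.
    + destruct golden_coef_ex_pseries as [l H]. exists l. revert H.
      apply is_pseries_ext. intros n. symmetry. apply q_real_golden.
Qed.
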